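(* Let $N>1$, let $d>1$ be a divisor of $N$, put $d'=N/d$ and $d''=\gcd(d,d')$, and let $b\in(\mathbb{Z}/d'')^*$. Then the width of the cusp class of $\Gamma_0(N)$ represented by $(d;b)$ (that is, of $\chi^{-1}(d;b)$) is the sum of the widths $W_j$ of all the $1/j$, with $0\le j<N$ and $\gcd(j,N)>1$, such that $\chi([1/j])=(d;b)$. That is, $$\frac{d'}{d''}=\sum_{k\in K_b}W_{dk},$$ where $K_b=(\pi^{*d'}_{d''})^{-1}(b)\subset(\mathbb{Z}/d')^*$ is the preimage of $b$ under the natural homomorphism $\pi^{*d'}_{d''}:(\mathbb{Z}/d')^*\to(\mathbb{Z}/d'')^*$.
   Context: Notation: $\mathbb{N}=\mathbb{Z}_{>0}$; $\mathbb{Z}/n=\mathbb{Z}/n\mathbb{Z}$, with $(\mathbb{Z}/n)^*$ its group of units (for $n=1$ this is the one-element group). $W:\mathbb{Z}/N\to\mathbb{N}$ is defined by $W_j=\min\{m\in\mathbb{N}\mid mj-1\in(\mathbb{Z}/N)^*\}$; for an integer $j$, $W_j$ means $W$ of its class mod $N$. In $W_{dk}$ with $k\in(\mathbb{Z}/d')^*$, the symbol $k$ also denotes its integer lift between $1$ and $d'$, so $dk$ is a well-defined class mod $N=dd'$. By convention $\gcd(0,N)=N$. The group $\Gamma_0(N)$ acts on $P^1(\mathbb{Q})=\mathbb{Q}\cup\{\infty\}$ by Möbius transformations; the set of orbits is the set $C_0(N)$ of cusp classes, and $[s]$ denotes the class of $s$. Elements of $P^1(\mathbb{Q})$ are written in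 reduced form $a/c$ with $a,c\in\mathbb{Z}$, $\gcd(a,c)=1$, and $\infty=\pm1/0$ (so $1/0=\infty$). There is a (known) bijection $$\chi:C_0(N)\to\bigcup_{d\mid N}(\mathbb{Z}/d'')^*\ (\text{disjoint union, } d''=\gcd(d,N/d)),\qquad [a/c]\mapsto(d=\gcd(c,N);\ (a\cdot c/d)\bmod d'').$$ The width of a cusp class $[s]$ of $\Gamma_0(N)$ is the usual one: if $\gamma\in SL_2(\mathbb{Z})$ with $\gamma(\infty)=s$, it is the smallest $h\in\mathbb{N}$ with $\gamma\begin{pmatrix}1&h\\0&1\end{pmatrix}\gamma^{-1}\in\Gamma_0(N)$ (up to sign $\pm$). It is known that the class with invariant $(d;b)$ has width $d'/d''$. In contrast, for $0\le j<N$ with $\gcd(j,N)>1$, the ''width'' of the individual cusp $1/j$ (coming from a particular fundamental domain) is by definition $W_j$. *)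

(* Defs.v *)
From mathcomp Require Import all_boot all_order all_algebra.
From mathcomp Require Import boolp.
From mathcomp Require Import ring.

Set Implicit Arguments.
Unset Strict Implicit.
Unset Printing Implicit Defensive.

Import Order.TTheory GRing.Theory Num.Theory.
Local Open Scope ring_scope.
Local Open Scope quotient_scope.

(* Z/n for n > 0.  ['Z_n] is not usable here because ['Z_1] is Z/2, whereas
   the moduli below may be 1.  The additive group structure and the product
   [Zp_mul] are those of zmodp.  For n = 0 (never used) this is the trivial
   group. *)
Notation Zmod n := 'I_(n.-1.+1).

Definition Zmod_units (n : nat) : {set Zmod n} :=
  [set x | [exists y, Zp_mul x y == Zp1]].

Definition Zres (n : nat) (x : int) : Zmod n := Zp1 *~ x.

(* The natural map Z/m -> Z/n when n divides m. *)
Definition Zmod_red (m n : nat) (k : Zmod m) : Zmod n := Zres n (k : nat)%:Z.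

(* The integer representative between 1 and n. *)
Definition Zlift (n : nat) (k : Zmod n) : nat :=
  if k == 0 :> nat then n else k.

Lemma W_subproof (N : nat) (j : Zmod N) :
  exists m, (0 < m)%N && (j *+ m - Zp1 \in Zmod_units N).
Proof.
exists N.-1.+1; rewrite /= Zp_mulrn.
have -> : inZp (j * N.-1.+1) = 0 :> Zmod N.
  by apply: val_inj; rewrite /= modnMl.
rewrite sub0r inE; apply/existsP; exists (- Zp1).
case: N.-1 {j} => [|n]; first by apply/eqP; apply: val_inj; rewrite !ord1.
by have := @mulrNN 'I_n.+2 1 1; rewrite mulr1 => /eqP.
Qed.

Definition W (N : nat) (j : Zmod N) : nat := ex_minn (W_subproof j).

(* P^1(Q), with [None] the point at infinity. *)
Notation P1Q := (option rat).

(* The point x/y, for (x, y) <> (0, 0). *)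
Definition P1pt (x y : rat) : P1Q := if y == 0 then None else Some (x / y).

(* The reduced form of a point; the sign is fixed by taking denominators
   nonnegative, and infinity = 1/0. *)
Definition pnum (s : P1Q) : int := if s is Some z then numq z else 1.
Definition pden (s : P1Q) : int := if s is Some z then denq z else 0.

Definition SL2Z : {pred 'M[int]_2} := [pred g | \det g == 1].

Definition Gamma0 (N : nat) : {pred 'M[int]_2} :=
  [pred g in SL2Z | (N%:Z %| g ord_max ord0)%Z].

Definition mobius (g : 'M[int]_2) (s : P1Q) : P1Q :=
  let a := (g ord0 ord0)%:~R in let b := (g ord0 ord_max)%:~R in
  let c := (g ord_max ord0)%:~R in let d := (g ord_max ord_max)%:~R in
  match s with
  | Some z => P1pt (a * z + b) (c * z + d)
  | None => P1pt a c
  end.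

Definition cusp_rel (N : nat) (s t : P1Q) : bool :=
  `[< exists2 g, g \in Gamma0 N & t = mobius g s >].

Section MobiusAction.

Definition hcoord (s : P1Q) : rat * rat := if s is Some z then (z, 1) else (1, 0).

Lemma mobius_hcoord g s : mobius g s =
  P1pt ((g ord0 ord0)%:~R * (hcoord s).1 + (g ord0 ord_max)%:~R * (hcoord s).2)
    ((g ord_max ord0)%:~R * (hcoord s).1 + (g ord_max ord_max)%:~R * (hcoord s).2).
Proof. by case: s => [z|] /=; rewrite !mulr1 ?mulr0 ?addr0. Qed.

Lemma P1pt_hcoord s : P1pt (hcoord s).1 (hcoord s).2 = s.
Proof. by case: s => [z|] //=; rewrite /P1pt oner_eq0 divr1. Qed.

Lemma P1pt_scale l x y : l != 0 -> P1pt (l * x) (l * y) = P1pt x y.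
Proof.
move=> l0; rewrite /P1pt mulf_eq0 (negPf l0) /=.
by case: eqP => // _; rewrite -mulf_div divff ?mul1r.
Qed.

Lemma hcoord_P1pt x y : (x != 0) || (y != 0) ->
  exists2 l, l != 0 & x = l * (hcoord (P1pt x y)).1 /\ y = l * (hcoord (P1pt x y)).2.
Proof.
rewrite /P1pt; have [-> | y0 _] := eqVneq y 0.
  by rewrite orbF => x0; exists x => //=; rewrite mulr1 mulr0.
by exists y => //=; rewrite mulr1 mulrC divfK.
Qed.

Lemma det2 (R : comPzRingType) (g : 'M[R]_2) : \det g =
  g ord0 ord0 * g ord_max ord_max - g ord0 ord_max * g ord_max ord0.
Proof.
rewrite (expand_det_row _ ord0) big_ord_recl big_ord1 /cofactor !det_mx11 /=.
rewrite !mxE /= expr0 expr1 mul1r mulN1r mulrN.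
by congr (_ * g _ _ - g _ _ * g _ _); apply: val_inj.
Qed.

Lemma mulmx2 (R : pzRingType) (g h : 'M[R]_2) i j : (g *m h) i j =
  g i ord0 * h ord0 j + g i ord_max * h ord_max j.
Proof.
by rewrite mxE big_ord_recl big_ord1; congr (_ + g _ _ * h _ _); apply: val_inj.
Qed.

Lemma mobius1 s : mobius 1%:M s = s.
Proof. by rewrite mobius_hcoord !mxE /= !mul1r !mul0r addr0 add0r P1pt_hcoord. Qed.

Lemma mobiusM g h s : h \in SL2Z -> mobius (g *m h) s = mobius g (mobius h s).
Proof.
rewrite inE det2 => /eqP /(congr1 (fun z => z%:~R : rat)) det1.
rewrite rmorphB !rmorphM /= in det1.
rewrite (mobius_hcoord h) [LHS]mobius_hcoord !mulmx2.
set a := (h ord0 ord0)%:~R : rat in det1 *.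
set b := (h ord0 ord_max)%:~R : rat in det1 *.
set c := (h ord_max ord0)%:~R : rat in det1 *.
set d := (h ord_max ord_max)%:~R : rat in det1 *.
set x := (hcoord s).1; set y := (hcoord s).2.
have nz : (a * x + b * y != 0) || (c * x + d * y != 0).
  rewrite -negb_and; apply/negP => /andP[/eqP e1 /eqP e2].
  have ex : x = 0.
    have -> : x = d * (a * x + b * y) - b * (c * x + d * y).
      by rewrite -[LHS]mul1r -[1]det1; ring.
    by rewrite e1 e2 !mulr0 subr0.
  have ey : y = 0.
    have -> : y = a * (c * x + d * y) - c * (a * x + b * y).
      by rewrite -[LHS]mul1r -[1]det1; ring.
    by rewrite e1 e2 !mulr0 subr0.
  by move: ex ey; rewrite /x /y; case: s {x y e1 e2} => [z|] /= e1 e2;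
     move: (oner_neq0 rat); rewrite ?e1 ?e2 ?eqxx // -?e1 -?e2 eqxx.
have [l l0 [e1 e2]] := hcoord_P1pt nz.
rewrite (mobius_hcoord g) -[RHS](P1pt_scale _ _ l0) !rmorphD !rmorphM /=.
rewrite -/a -/b -/c -/d !mulrDr !(mulrCA l) -e1 -e2.
by congr (P1pt _ _); ring.
Qed.

Lemma SL2Z_mul g h : g \in SL2Z -> h \in SL2Z -> g *m h \in SL2Z.
Proof. by rewrite !inE det_mulmx => /eqP-> /eqP->. Qed.

Lemma SL2Z_adj g : g \in SL2Z -> \adj g \in SL2Z.
Proof.
rewrite !inE => /eqP g1; have := congr1 determinant (mul_mx_adj g).
by rewrite det_mulmx g1 det1 mul1r => ->.
Qed.

Lemma adj2_10 (g : 'M[int]_2) : \adj g ord_max ord0 = - g ord_max ord0.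
Proof.
rewrite mxE /cofactor det_mx11 /= !mxE /= expr1 mulN1r.
by congr (- g _ _); apply: val_inj.
Qed.

Lemma Gamma0_mul N g h :
  g \in Gamma0 N -> h \in Gamma0 N -> g *m h \in Gamma0 N.
Proof.
move=> /andP[g1 gN] /andP[h1 hN]; apply/andP; split; first exact: SL2Z_mul.
by rewrite mulmx2; apply: rpredD; [exact: dvdz_mulr | exact: dvdz_mull].
Qed.

Lemma Gamma0_adj N g : g \in Gamma0 N -> \adj g \in Gamma0 N.
Proof.
by move=> /andP[g1 gN]; apply/andP; split; [exact: SL2Z_adj | rewrite adj2_10 rpredN].
Qed.

Lemma mobius_adj g s : g \in SL2Z -> mobius (\adj g) (mobius g s) = s.
Proof.
move=> g1; rewrite -mobiusM // mul_adj_mx; move: g1; rewrite inE => /eqP ->.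
exact: mobius1.
Qed.

End MobiusAction.

Lemma cusp_rel_refl N : reflexive (cusp_rel N).
Proof.
move=> s; apply/asboolP; exists 1%:M; last by rewrite mobius1.
by rewrite !inE det1 eqxx mxE /= dvdz0.
Qed.

Lemma cusp_rel_sym N : symmetric (cusp_rel N).
Proof.
have H s t : cusp_rel N s t -> cusp_rel N t s.
  move=> /asboolP[g gN ->]; apply/asboolP; exists (\adj g).
    exact: Gamma0_adj.
  by rewrite mobius_adj //; case/andP: gN.
by move=> s t; apply/idP/idP; apply: H.
Qed.

Lemma cusp_rel_trans N : transitive (cusp_rel N).
Proof.
move=> t s u /asboolP[g gN ->] /asboolP[h hN ->]; apply/asboolP.
exists (h *m g); first exact: Gamma0_mul.
by rewrite mobiusM //; case/andP: gN.
Qed.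

Canonical cusp_equiv N : equiv_rel P1Q := EquivRel (cusp_rel N)
  (@cusp_rel_refl N) (@cusp_rel_sym N) (@cusp_rel_trans N).

(* The set of cusp classes, i.e., of orbits of [Gamma0 N] on P^1(Q). *)
Definition C0 (N : nat) : Type := {eq_quot (cusp_equiv N)}.

Definition cusp (N : nat) (s : P1Q) : C0 N := \pi_({eq_quot (cusp_equiv N)}) s.

Lemma cuspP N s t :
  reflect (exists2 g, g \in Gamma0 N & t = mobius g s) (cusp N s == cusp N t).
Proof. by rewrite /cusp eqmodE; apply: asboolP. Qed.

Definition codiv (N d : nat) : nat := gcdn d (N %/ d).

(* The invariants (d; b), with d dividing N and b in Z/gcd(d, N/d). *)
Definition cusp_inv (N : nat) : Type := {d : nat & Zmod (codiv N d)}.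

Definition mk_inv (N d : nat) (b : Zmod (codiv N d)) : cusp_inv N :=
  Tagged (fun d => Zmod (codiv N d)) b.

Definition inv_frac (N : nat) (a c : int) : cusp_inv N :=
  let d := gcdn `|c| N in
  mk_inv (Zres (codiv N d) (a * (c %/ d%:Z)%Z)).

(* Evaluated at a chosen representative of the class; see [chi_cusp]. *)
Definition chi (N : nat) (C : C0 N) : cusp_inv N :=
  inv_frac N (pnum (repr C)) (pden (repr C)).

Lemma Zres_eq n (x y : int) : (n%:Z %| x - y)%Z -> Zres n x = Zres n y.
Proof.
move=> /dvdzP[q e]; rewrite /Zres -[x](subrK y) e mulrzDr.
suff -> : (Zp1 : Zmod n) *~ (q * n%:Z) = 0 by rewrite add0r.
rewrite mulrC mulrzA -pmulrn Zp_mulrn.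
have -> : inZp ((Zp1 : Zmod n) * n) = 0 :> Zmod n.
  case: n {x y q e} => [|n]; apply: val_inj; rewrite /= ?muln0 ?mod0n //.
  by rewrite modnMl.
by rewrite mul0rz.
Qed.

Lemma inv_fracN N a c : (0 < N)%N -> inv_frac N (- a) (- c) = inv_frac N a c.
Proof.
move=> N0; rewrite /inv_frac abszN; congr mk_inv; congr Zres.
have /dvdzP[q] : ((gcdn `|c| N)%:Z %| c)%Z by rewrite dvdzE dvdn_gcdl.
have dz : (gcdn `|c| N)%:Z != 0 by rewrite eqz_nat -lt0n gcdn_gt0 N0 orbT.
move: (gcdn _ _) dz => d dz ->.
by rewrite -mulNr !mulzK // mulrNN.
Qed.

Lemma inv_frac_Gamma0 N (g : 'M[int]_2) a c : (0 < N)%N -> g \in Gamma0 N ->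
  inv_frac N (g ord0 ord0 * a + g ord0 ord_max * c)
             (g ord_max ord0 * a + g ord_max ord_max * c) = inv_frac N a c.
Proof.
move=> N0 /andP[]; rewrite inE det2 => /eqP.
set p := g ord0 ord0; set q := g ord0 ord_max.
set s := g ord_max ord_max => D /dvdzP[r er].
rewrite er in D *.
set c' := r * N%:Z * a + s * c.
have ed : gcdn `|c'| N = gcdn `|c| N.
  have cop : coprime N `|s|.
    rewrite coprime_sym -[N]/(`|N%:Z|%N) -coprimezE; apply/coprimezP.
    by exists (p, - (q * r)) => /=; rewrite -D; ring.
  rewrite gcdnC [RHS]gcdnC -[RHS](Gauss_gcdr _ cop) -abszM.
  have -> : c' = (r * a) * N%:Z + s * c by rewrite /c'; ring.
  by have [] := gcdzMDl (r * a) N%:Z (s * c).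
rewrite /inv_frac ed; congr mk_inv; apply: Zres_eq.
have d0 : (0 < gcdn `|c| N)%N by rewrite gcdn_gt0 N0 orbT.
have dc : ((gcdn `|c| N)%:Z %| c)%Z by rewrite dvdzE dvdn_gcdl.
have [N1 eN] := dvdnP (dvdn_gcdr `|c| N).
move: dc d0 eN D; rewrite /c' => {c' ed}; move: (gcdn _ _) => d.
move=> /dvdzP[c1 ->] d0 -> D; rewrite PoszM in D *.
have dz : d%:Z != 0 by rewrite eqz_nat -lt0n.
have -> : r * (N1%:Z * d%:Z) * a + s * (c1 * d%:Z) = (r * N1%:Z * a + s * c1) * d%:Z.
  by ring.
rewrite !mulzK // /codiv mulnK //.
set e := gcdn _ _.
have ed : (e%:Z %| d%:Z)%Z by rewrite dvdzE dvdn_gcdl.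
have eN1 : (e%:Z %| N1%:Z)%Z by rewrite dvdzE dvdn_gcdr.
have -> : (p * a + q * (c1 * d%:Z)) * (r * N1%:Z * a + s * c1) - a * c1 =
  (p * a * a * r) * N1%:Z + (q * c1 * (s * c1 + 2 * r * N1%:Z * a)) * d%:Z.
  rewrite -[X in _ - X]mulr1 -[X in _ - _ * X]D; ring.
by apply: rpredD; apply: dvdz_mull.
Qed.

Lemma pnum_pden_P1pt (a c : int) : coprimez a c ->
  exists b : bool, (-1) ^+ b * pnum (P1pt a%:~R c%:~R) = a /\
                   (-1) ^+ b * pden (P1pt a%:~R c%:~R) = c.
Proof.
rewrite /P1pt intr_eq0 coprimezE; have [-> | c0 cop] := eqVneq c 0.
  rewrite /coprime gcdn0 => /eqP a1; exists (a < 0); rewrite /= mulr1 mulr0.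
  by split=> //; rewrite [RHS]intEsign a1 mulr1.
exists (c < 0); rewrite /= coprimeq_num // coprimeq_den // (negPf c0).
by rewrite neqr0_sign // mulrA -expr2 sqr_sg c0 mul1r -numEsg.
Qed.

Lemma coprime_pnum_pden s : coprimez (pnum s) (pden s).
Proof. by case: s => [z|] //=; rewrite coprimezE coprime_num_den. Qed.

Lemma mobius_frac g s : mobius g s =
  P1pt (g ord0 ord0 * pnum s + g ord0 ord_max * pden s)%:~R
        (g ord_max ord0 * pnum s + g ord_max ord_max * pden s)%:~R.
Proof.
case: s => [z|] /=; last by rewrite !mulr1 !mulr0 !addr0.
have dz : (denq z)%:~R != 0 :> rat by rewrite intr_eq0 denq_neq0.
rewrite -(P1pt_scale _ _ dz) !rmorphD !rmorphM /= numqE.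
by congr P1pt; ring.
Qed.

Lemma P1pt_frac s : P1pt (pnum s)%:~R (pden s)%:~R = s.
Proof. by case: s => [z|] //=; rewrite /P1pt intr_eq0 (negPf (denq_neq0 z)) divq_num_den. Qed.

Lemma inv_frac_reduced N (a c : int) : (0 < N)%N -> coprimez a c ->
  inv_frac N (pnum (P1pt a%:~R c%:~R)) (pden (P1pt a%:~R c%:~R)) = inv_frac N a c.
Proof.
move=> N0 /pnum_pden_P1pt[b []].
move: (pnum _) (pden _) => x y <- <-.
by case: b; rewrite ?expr0 ?expr1 ?mulN1r ?mul1r ?inv_fracN.
Qed.

(* [chi] is well defined and given by the expected formula. *)
Lemma chi_cusp N (a c : int) : (0 < N)%N -> coprimez a c ->
  chi (cusp N (P1pt a%:~R c%:~R)) = inv_frac N a c.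
Proof.
move=> N0 cop; rewrite /chi; set s := P1pt _ _.
have /cuspP[g gN ->] : cusp N s == cusp N (repr (cusp N s)).
  by rewrite /cusp reprK.
rewrite mobius_frac inv_frac_reduced // ?inv_frac_Gamma0 ?inv_frac_reduced //.
have /coprimezP[[u v] /= uv] := coprime_pnum_pden s.
case/andP: gN; rewrite inE det2 => /eqP D _; apply/coprimezP.
exists (u * g ord_max ord_max - v * g ord_max ord0,
        v * g ord0 ord0 - u * g ord0 ord_max) => /=.
by rewrite -uv -[RHS]mul1r -D; ring.
Qed.

Definition transl (h : nat) : 'M[int]_2 :=
  \matrix_(i, j) if (i == ord0) && (j == ord_max) then h%:Z else (i == j)%:R.

Definition conj_transl_in (N : nat) (g : 'M[int]_2) (h : nat) : bool :=
  let u := g * transl h * g^-1 in (u \in Gamma0 N) || (- u \in Gamma0 N).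

(* h is the width of the class C, whichever g is used to compute it.  Some g
   always exists ([SL2Z_trans]), so h is determined by C ([is_width_uniq]). *)
Definition is_width (N : nat) (C : C0 N) (h : nat) : Prop :=
  forall g, g \in SL2Z -> cusp N (mobius g None) = C ->
    [/\ (0 < h)%N, conj_transl_in N g h &
        forall m, (0 < m)%N -> conj_transl_in N g m -> (h <= m)%N].

Lemma SL2Z_trans s : exists2 g, g \in SL2Z & mobius g None = s.
Proof.
have /coprimezP[[u v] /= uv] := coprime_pnum_pden s.
pose g : 'M[int]_2 := \matrix_(i, j)
  (if i == ord0 then (if j == ord0 then pnum s else - v)
   else (if j == ord0 then pden s else u)).
exists g; first by rewrite inE det2 !mxE /= -uv; apply/eqP; ring.
by rewrite /= !mxE /= P1pt_frac.
Qed.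

Lemma is_width_uniq N (C : C0 N) h m : is_width C h -> is_width C m -> h = m.
Proof.
have [g g1 gC] := SL2Z_trans (repr C).
have eC : cusp N (mobius g None) = C by rewrite gC /cusp reprK.
move=> /(_ g g1 eC)[h0 hh hmin] /(_ g g1 eC)[m0 mm mmin].
by apply/eqP; rewrite eqn_leq hmin ?mmin.
Qed.

(* The preimage of b in the units of Z/(N/d). *)
Definition K (N d : nat) (b : Zmod (codiv N d)) : {set Zmod (N %/ d)} :=
  [set k in Zmod_units (N %/ d) | Zmod_red (codiv N d) k == b].

(* Main.v *)
(* Fix k0 in K b, put x0 = d k0 and h = d'/d''.  Translating the cusp 1/x0 runs
   through the points (x0 : m x0 - 1) of P^1(Z/N), with period h; such a point is
   of the form (x : -1) exactly when 1 - m x0 is a unit, and then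
   x = x0 / (1 - m x0).  The x met in this way during one period are the d k with
   k in K b, each once, and W_x is the waiting time until the next one.  The
   waiting times add up to the period h, which is also the width because
   N | m c^2 iff h | m when gcd(c, N) = d. *)

Require Import Defs.
From mathcomp Require Import all_boot all_order all_algebra.
From mathcomp Require Import ring zify.

Set Implicit Arguments.
Unset Strict Implicit.
Unset Printing Implicit Defensive.

Import GRing.Theory Num.Theory.
Local Open Scope ring_scope.

(** * Integer representatives of residues, units, and [W] *)

Lemma val_Zres_nat n (m : nat) : (0 < n)%N -> (Zres n m%:Z : nat) = (m %% n)%N.
Proof.
case: n => [|[|n]] // _; rewrite /Zres -pmulrn Zp_mulrn /= ?modn1 //.
by rewrite modnMml mul1n.
Qed.

Lemma val_Zres n (x : int) : (0 < n)%N -> (Zres n x : nat)%:Z = (x %% n%:Z)%Z.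
Proof.
move=> n0; have nz : n%:Z != 0 by rewrite eqz_nat -lt0n.
have e : Zres n x = Zres n (x %% n)%Z.
  by apply: Zres_eq; rewrite -eqz_mod_dvd modz_mod.
rewrite e; have := modz_ge0 x nz; have := ltz_pmod x (_ : 0 < n%:Z).
by case: (x %% n)%Z => // r /(_ n0) rn _; rewrite val_Zres_nat // modn_small.
Qed.

Lemma Zres_eqE n (x y : int) : (0 < n)%N -> (Zres n x == Zres n y) = (n%:Z %| x - y)%Z.
Proof.
by move=> n0; rewrite -val_eqE /= -eqz_nat !val_Zres // eqz_mod_dvd.
Qed.

Lemma Zres_val n (x : Zmod n) : Zres n (x : nat)%:Z = x.
Proof.
case: n x => [|n] x; first by rewrite !ord1.
by apply: val_inj; apply: etrans (val_Zres_nat _ _) _; rewrite // modn_small.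
Qed.

Lemma Zp_mul_Zres n (x y : int) : (0 < n)%N ->
  Zp_mul (Zres n x) (Zres n y) = Zres n (x * y).
Proof.
case: n => // n n0; apply: val_inj; apply/eqP; rewrite -eqz_nat.
by rewrite val_Zres //= -modz_nat PoszM !val_Zres // modzMm.
Qed.

Lemma Zp1_Zres n : Zp1 = Zres n 1.
Proof. by []. Qed.

Lemma coprimezPdvd (n : nat) (x : int) :
  reflect (exists y, (n%:Z %| x * y - 1)%Z) (coprimez x n).
Proof.
apply: (iffP (coprimezP _ _)) => [[[u v] /= e]|[y /dvdzP[q e]]].
  by exists u; apply/dvdzP; exists (- v); rewrite -e; ring.
by exists (y, - q); rewrite /= mulNr -e; ring.
Qed.

Lemma Zres_unit n (x : int) : (0 < n)%N -> (Zres n x \in Zmod_units n) = coprimez x n.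
Proof.
move=> n0; rewrite inE; apply/existsP/coprimezPdvd => -[y].
  by rewrite -[y]Zres_val Zp_mul_Zres // Zp1_Zres Zres_eqE //; exists (y : nat)%:Z.
by exists (Zres n y); rewrite Zp_mul_Zres // Zp1_Zres Zres_eqE.
Qed.

(** Units are stable under negation, so m j - 1 may be traded for 1 - m j, the shape in which
    waiting times are compared below. *)
Lemma W_spec N (j : int) : (0 < N)%N ->
  [/\ (0 < W (Zres N j))%N, coprimez (1 - (W (Zres N j))%:Z * j) N &
      forall t, (0 < t)%N -> coprimez (1 - t%:Z * j) N -> (W (Zres N j) <= t)%N].
Proof.
move=> N0; rewrite /W; case: ex_minnP => m.
have E t : (Zres N j *+ t - Zp1 \in Zmod_units N) = coprimez (1 - t%:Z * j) N.
  rewrite -coprimeNz opprB -Zres_unit //.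
  by rewrite /Zres mulrzBr mulrC mulrzA -pmulrn.
rewrite E => /andP[m0 cm] min; split=> // t t0 ct; apply: min.
by rewrite t0 E.
Qed.

(** * Divisibility, lifting of units, and sums of gaps *)

(** Cancel d, then k^2, which is prime to d'. With d = e g, d' = h g and e, h coprime, h g | m e g
    reduces to h | m. *)
Lemma dvdz_mul_sqr (d d' : nat) (k m : int) : (0 < d)%N -> (0 < d')%N ->
  coprimez k d' ->
  ((d * d')%N%:Z %| m * (d%:Z * k) ^+ 2)%Z = ((d' %/ gcdn d d')%N%:Z %| m)%Z.
Proof.
move=> d0 d'0 ck; have dz : d%:Z != 0 by rewrite eqz_nat -lt0n.
have g0 : (0 < gcdn d d')%N by rewrite gcdn_gt0 d0.
rewrite (_ : m * _ = d%:Z * (m * d%:Z * k ^+ 2)); last by ring.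
rewrite PoszM dvdz_mul2l // Gauss_dvdzl; last by rewrite coprimezXr // coprimez_sym.
have [e ee] := dvdnP (dvdn_gcdl d d'); have [h eh] := dvdnP (dvdn_gcdr d d').
have che : coprimez h e.
  rewrite coprimezE /= /coprime -(eqn_pmul2r g0) muln_gcdl.
  by rewrite -ee -eh mul1n gcdnC.
move: (gcdn d d') g0 ee eh => g g0 -> ->.
by rewrite mulnK // !PoszM mulrA dvdz_mul2r ?Gauss_dvdzl // eqz_nat -lt0n.
Qed.

(** Surjectivity of (Z/m)^* -> (Z/n)^*. Let r be the largest divisor of m prime to n, and take k
    equal to b modulo n and to 1 modulo r. A prime factor of m divides n or r, so it cannot divide
    k. *)
Lemma unit_lift (m n : nat) (b : int) : (0 < m)%N -> (n %| m)%N -> coprimez b n ->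
  exists2 k, coprimez k m & (n%:Z %| k - b)%Z.
Proof.
move=> m0 nm cb; have n0 := dvdn_gt0 m0 nm.
pose r := (m`_(\pi(n)^'))%N.
have cnr : coprimez n r.
  by rewrite coprimezE; apply: pnat_coprime (pnat_pi n0) (part_pnat _ _).
pose k := zchinese n r b 1.
have kb : (n%:Z %| k - b)%Z by rewrite -eqz_mod_dvd; apply/eqP/zchinese_modl.
have k1 : (r%:Z %| k - 1)%Z by rewrite -eqz_mod_dvd; apply/eqP/zchinese_modr.
exists k => //; rewrite coprimezE /=; apply/negPn/negP => nc.
have g0 : (0 < gcdn `|k| m)%N by rewrite gcdn_gt0 m0 orbT.
have g1 : (1 < gcdn `|k| m)%N by rewrite ltn_neqAle eq_sym nc g0.
set p := pdiv (gcdn `|k| m); have pp : prime p by exact: pdiv_prime.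
have pg : (p %| gcdn `|k| m)%N by exact: pdiv_dvd.
have pk : (p%:Z %| k)%Z by rewrite dvdzE (dvdn_trans pg) // dvdn_gcdl.
have pm : (p %| m)%N by rewrite (dvdn_trans pg) // dvdn_gcdr.
suff : (p%:Z %| 1)%Z by rewrite dvdzE /= dvdn1 => /eqP p1; rewrite p1 in pp.
have [pn|pn] := boolP (p %| n)%N.
  have /coprimezP[[u v] /= e] := cb.
  rewrite -[X in (_ %| X)%Z]e rpredD // dvdz_mull //.
  by rewrite -[b](subKr k) rpredB // (dvdz_trans _ kb).
rewrite -[X in (_ %| X)%Z](subKr k) rpredB // (dvdz_trans _ k1) // dvdzE /= /r.
rewrite -(Gauss_dvdr (n := (m`_\pi(n))%N)) ?partnC //.
rewrite prime_coprime //; apply/negP => pp'.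
have := part_pnat \pi(n) m; move=> /pnatP; rewrite part_gt0 => /(_ isT) /(_ p pp pp').
by rewrite mem_primes pp n0 (negPf pn).
Qed.

Lemma sum_gaps (P : pred nat) (g : nat -> nat) h : P 0 -> P h ->
  (forall m, P m -> [/\ (0 < g m)%N, P (m + g m)%N &
     forall t, (0 < t)%N -> P (m + t)%N -> (g m <= t)%N]) ->
  (\sum_(m < h | P m) g m = h)%N.
Proof.
move=> P0 Ph gP.
(* Induction invariant: the gaps starting below h add up to the first point of P at or after h,
   written h + e. As h lies in P, e = 0. *)
have [e [-> _ emin]] : exists e, [/\ (\sum_(m < h | P m) g m = h + e)%N,
    P (h + e)%N & forall t, (t < e)%N -> ~~ P (h + t)%N].
  elim: h {Ph} => [|n [e [IH Pe emin]]].
    by exists 0; rewrite big_ord0; split.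
  rewrite big_mkcond big_ord_recr -big_mkcond /= IH; case: ifPn => Pn.
    have e0 : e = 0%N.
      by case: e emin {IH Pe} => // e /(_ 0%N isT); rewrite addn0 Pn.
    (* The next point n + g n lies at distance g n - 1 from n + 1. *)
    have [g0 Pg gmin] := gP n Pn; exists (g n).-1.
    rewrite addSnnS prednK // e0 addn0; split=> // t lt.
    by apply/negP; rewrite addSnnS => /(gmin _ (ltn0Sn t)); lia.
  case: e IH Pe emin => [|e] IH Pe emin; first by rewrite addn0 (negPf Pn) in Pe.
  exists e; rewrite addn0 addSnnS; split=> // t te.
  by rewrite addSnnS; apply: emin.
by case: e emin => [|e /(_ 0%N isT)]; rewrite addn0 // Ph.
Qed.

(** * The fibre [K b] and the sum of [W] over it *)

Lemma codiv_dvdl N d : (codiv N d %| d)%N.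
Proof. exact: dvdn_gcdl. Qed.

Lemma codiv_dvdr N d : (codiv N d %| N %/ d)%N.
Proof. exact: dvdn_gcdr. Qed.

Lemma in_K N d (b : Zmod (codiv N d)) (x : int) : (0 < N %/ d)%N ->
  (Zres (N %/ d) x \in K b) = coprimez x (N %/ d)%N && (Zres (codiv N d) x == b).
Proof.
move=> d'0; rewrite inE Zres_unit // /Zmod_red; congr (_ && (_ == b)).
apply: Zres_eq; apply: (@dvdz_trans (N %/ d)%N); first by rewrite dvdzE codiv_dvdr.
by rewrite val_Zres // -eqz_mod_dvd modz_mod.
Qed.

Lemma K_nonempty N d (b : Zmod (codiv N d)) : (0 < N %/ d)%N ->
  b \in Zmod_units (codiv N d) -> exists k : int, Zres (N %/ d) k \in K b.
Proof.
move=> d'0; have g0 := dvdn_gt0 d'0 (codiv_dvdr N d).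
rewrite -[b]Zres_val Zres_unit // => cb.
have [k ck kb] := unit_lift d'0 (codiv_dvdr N d) cb.
by exists k; rewrite in_K // ck Zres_eqE.
Qed.

Lemma coprimez_mod (n : nat) (x y : int) : (0 < n)%N ->
  (n%:Z %| x - y)%Z -> coprimez x n = coprimez y n.
Proof. by move=> n0 /Zres_eq e; rewrite -!Zres_unit // e. Qed.

(** A Bezout coefficient: an inverse of x modulo n when x is prime to n, and without meaning
    otherwise. *)
Definition Zinv (n : nat) (x : int) : int := (egcdz x n).1.

Lemma Zinv_dvd (n : nat) x : coprimez x n -> (n%:Z %| x * Zinv n x - 1)%Z.
Proof.
rewrite /Zinv; case: egcdzP => u v e _ /= /eqP cx.
by rewrite cx in e; apply/dvdzP; exists (- v); rewrite -e; ring.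
Qed.

(* For k = k0 / (1 - m d k0), the identity
   1 - t d k = (1 - (m + t) d k0) / (1 - m d k0) makes W (d k) the distance from m
   to the next m' such that 1 - m' d k0 is a unit. *)
Lemma sum_W_K N d (b : Zmod (codiv N d)) : (0 < N)%N -> (d %| N)%N ->
  b \in Zmod_units (codiv N d) ->
  (\sum_(k in K b) W (Zres N (d%:Z * (k : nat)%:Z)) = (N %/ d) %/ codiv N d)%N.
Proof.
move=> N0 dN bU.
have d0 := dvdn_gt0 N0 dN.
have d'0 : (0 < N %/ d)%N by rewrite divn_gt0 // dvdn_leq.
have [k0] := K_nonempty d'0 bU; rewrite in_K // => /andP[ck0 /eqP k0b].
have g0 := dvdn_gt0 d'0 (codiv_dvdr N d).
have eN : N%:Z = d%:Z * (N %/ d)%N%:Z by rewrite -PoszM mulnC divnK.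
set h := ((N %/ d) %/ codiv N d)%N.
have hP m : (N%:Z %| m * (d%:Z * k0) ^+ 2)%Z = (h%:Z %| m)%Z.
  by rewrite -(dvdz_mul_sqr m d0 d'0 ck0) mulnC divnK.
have dz : d%:Z != 0 by rewrite eqz_nat -lt0n.
have Nd (x : int) : (N%:Z %| d%:Z * x)%Z = ((N %/ d)%N%:Z %| x)%Z.
  by rewrite eN dvdz_mul2l.
have d'N : ((N %/ d)%N%:Z %| N%:Z)%Z by rewrite dvdzE; apply: dvdn_div.
pose q (m : nat) := 1 - m%:Z * (d%:Z * k0).
pose P := fun m : nat => coprimez (q m) N.
(* With x0 = d k0, this is the k with d k = x0 / (1 - m x0); its class modulo d' fixes d k modulo
   N. *)
pose f m := Zres (N %/ d) (k0 * Zinv N (q m)).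
have qV m : P m -> (N%:Z %| q m * Zinv N (q m) - 1)%Z by exact: Zinv_dvd.
have fE m : P m -> Zres N (d%:Z * (f m : nat)%:Z) = Zres N (d%:Z * (k0 * Zinv N (q m))).
  move=> Pm; apply/eqP; rewrite Zres_eqE // -mulrBr Nd.
  by rewrite val_Zres // -eqz_mod_dvd modz_mod.
have f_inj : {in [set m : 'I_h | P m] &, injective (fun m : 'I_h => f m)}.
  move=> m m'; rewrite !inE => Pm Pm' /eqP; rewrite Zres_eqE // => e.
  (* Clear denominators in x0 / q m = x0 / q m' modulo N; then h | m' - m, with both below h. *)
  have : (N%:Z %| (m'%:Z - m%:Z) * (d%:Z * k0) ^+ 2)%Z.
    have e1 := qV m Pm; have e2 := qV m' Pm'; rewrite -Nd in e.
    set u := Zinv N (q m) in e e1; set u' := Zinv N (q m') in e e2.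
    have -> : (m'%:Z - m%:Z) * (d%:Z * k0) ^+ 2 =
        (d%:Z * k0 * q m') * (q m * u - 1) - (d%:Z * k0 * q m) * (q m' * u' - 1)
        - (q m * q m') * (d%:Z * (k0 * u - k0 * u')) by rewrite /q; ring.
    by apply: rpredB; [apply: rpredB|]; apply: dvdz_mull.
  rewrite hP -eqz_mod_dvd !modz_nat eqz_nat !modn_small // => /eqP mm.
  exact: val_inj.
have <- : [set f m | m : 'I_h in [set m : 'I_h | P m]] = K b.
  apply/setP => x; apply/imsetP/idP => [[m]|].
    rewrite inE => Pm ->; have e := qV m Pm; rewrite in_K // coprimezMl ck0 /=.
    apply/andP; split.
      by apply/coprimezPdvd; exists (q m); rewrite mulrC; apply: dvdz_trans e.
    rewrite -k0b Zres_eqE //.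
    (* As d'' divides d, q m is 1 modulo d'', so dividing k0 by it keeps the class b. *)
    have -> : k0 * Zinv N (q m) - k0 = k0 * (q m * Zinv N (q m) - 1)
        + (k0 * m%:Z * k0 * Zinv N (q m)) * d%:Z by set u := Zinv _ _; rewrite /q; ring.
    apply: rpredD; apply: dvdz_mull; last by rewrite dvdzE codiv_dvdl.
    by apply: dvdz_trans e; rewrite dvdzE (dvdn_trans (codiv_dvdl N d)).
  rewrite -[x]Zres_val; move: (x : nat)%:Z => k {x}.
  rewrite in_K // -k0b Zres_eqE // => /andP[ck /dvdzP[t et]].
  have /coprimezPdvd[w /dvdzP[r er]] : coprimez (k * k0) (N %/ d)%N.
    by rewrite coprimezMl ck.
  have [al [be ab]] := Bezoutz d%:Z (N %/ d)%N%:Z.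
  have {}ab : al * d%:Z + be * (N %/ d)%N%:Z = (codiv N d)%:Z by [].
  have hz : h%:Z != 0 by rewrite eqz_nat -lt0n divn_gt0 // dvdn_leq // codiv_dvdr.
  (* The equation k (1 - M d k0) = k0 modulo d' reads M d k k0 = t d''. Since al d = d'' modulo d'
     and w inverts k k0, this M solves it. *)
  pose M := al * t * w.
  have Mh : (M %% h%:Z)%Z = `|(M %% h%:Z)%Z|%N by rewrite gez0_abs // modz_ge0.
  have mh : (`|(M %% h%:Z)%Z| < h)%N by rewrite -ltz_nat -Mh ltz_mod.
  move: Mh mh; move: `|_|%N => m Mm mh.
  have hM : (h%:Z %| m%:Z - M)%Z by rewrite -Mm -eqz_mod_dvd modz_mod.
  (* From d' = h d'' and d'' | d: replacing M by its residue m modulo h preserves the equation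
     modulo d'. *)
  have hd : ((N %/ d)%N%:Z %| h%:Z * d%:Z)%Z.
    rewrite dvdzE -PoszM /= -{1}(divnK (codiv_dvdr N d)).
    by rewrite dvdn_mul // codiv_dvdl.
  have kq : ((N %/ d)%N%:Z %| k * q m - k0)%Z.
    have -> : k * q m - k0 = (be * t) * (N %/ d)%N%:Z * (k * k0 * w)
        - t * (codiv N d)%:Z * (k * k0 * w - 1)
        - (m%:Z - M) * d%:Z * (k * k0) + (k - k0 - t * (codiv N d)%:Z).
      by rewrite -ab /q /M; ring.
    rewrite et subrr addr0 er.
    apply: rpredB; [apply: rpredB|].
    - by rewrite dvdz_mulr // dvdz_mull.
    - by rewrite mulrA dvdz_mull.
    rewrite dvdz_mulr //; apply: dvdz_trans hd _.
    by rewrite dvdz_mul.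
  (* Times d, the congruence says d k q m = d k0 modulo N, so q m (1 + m d k) = q m + m d k0 = 1. *)
  have Pm : P m.
    apply/coprimezPdvd; exists (1 + m%:Z * d%:Z * k).
    have -> : q m * (1 + m%:Z * d%:Z * k) - 1 = m%:Z * (d%:Z * (k * q m - k0)).
      by rewrite /q; ring.
    by rewrite dvdz_mull // Nd.
  exists (Ordinal mh); rewrite ?inE //; apply/eqP; rewrite Zres_eqE //=.
  have e := qV m Pm.
  have -> : k - k0 * Zinv N (q m) =
      Zinv N (q m) * (k * q m - k0) - k * (q m * Zinv N (q m) - 1) by ring.
  by apply: rpredB; apply: dvdz_mull => //; apply: dvdz_trans e.
rewrite big_imset //=.
under eq_bigl => m do rewrite inE.
under eq_bigr => m Pm do rewrite fE //.
apply: (sum_gaps (g := fun m => W (Zres N (d%:Z * (k0 * Zinv N (q m)))))).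
- by rewrite /P /q mul0r subr0 coprimezE /= /coprime gcd1n.
(* (1 - h x0)(1 + h x0) = 1 - h^2 x0^2, and N | h x0^2. *)
- apply/coprimezPdvd; exists (1 + h%:Z * (d%:Z * k0)).
  have -> : q h * (1 + h%:Z * (d%:Z * k0)) - 1 = - h%:Z * (h%:Z * (d%:Z * k0) ^+ 2).
    by rewrite /q; ring.
  by rewrite dvdz_mull // hP.
move=> m Pm; have [W0 PW Wmin] := W_spec (d%:Z * (k0 * Zinv N (q m))) N0.
have E t : coprimez (1 - t%:Z * (d%:Z * (k0 * Zinv N (q m)))) N = P (m + t)%N.
  have e := qV m Pm; rewrite /P.
  have /(coprimez_mod N0) <- : (N%:Z %| q m * (1 - t%:Z * (d%:Z * (k0 * Zinv N (q m))))
      - q (m + t)%N)%Z.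
    have -> : q m * (1 - t%:Z * (d%:Z * (k0 * Zinv N (q m)))) - q (m + t)%N =
        - (t%:Z * d%:Z * k0) * (q m * Zinv N (q m) - 1).
      by rewrite mulrBr mulr1 [X in _ - X - _]mulrCA /q PoszD; ring.
    exact: dvdz_mull.
  by rewrite coprimezMl [X in X && _]Pm.
by split; rewrite -?E // => t; rewrite -E; apply: Wmin.
Qed.

(** * Widths of cusp classes in terms of chi *)

(** If c is the lower left entry of g, that of g T^m g^-1 is - m c^2. Negating a 2 by 2 matrix
    preserves its determinant and the divisibility by N. *)
Lemma conj_transl_inE N g m : g \in SL2Z ->
  conj_transl_in N g m = (N%:Z %| m%:Z * g ord_max ord0 ^+ 2)%Z.
Proof.
move=> gS; have /eqP g1 : \det g == 1 by rewrite inE in gS.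
have gI : g^-1 = \adj g.
  by rewrite -[LHS]/(invmx g) /invmx unitmxE g1 unitr1 invr1 scale1r.
have detN (u : 'M[int]_2) : \det (- u) = \det u by rewrite !det2 !mxE; ring.
have tS : transl m \in SL2Z by rewrite inE det2 !mxE /= !mulr1 mulr0 subr0.
rewrite /conj_transl_in gI -!mulmxE.
set u := g *m _ *m _.
have uS : u \in SL2Z by apply: SL2Z_mul; [exact: SL2Z_mul | exact: SL2Z_adj].
have u10 : u ord_max ord0 = - (m%:Z * g ord_max ord0 ^+ 2).
  have adj00 : \adj g ord0 ord0 = g ord_max ord_max.
    rewrite mxE /cofactor det_mx11 /= !mxE /= expr0 mul1r.
    by congr (g _ _); apply: val_inj.
  rewrite !mulmx2 adj2_10 adj00 !mxE /=; ring.
have uN : (- u \in Gamma0 N) = (u \in Gamma0 N) by rewrite !inE detN mxE rpredN.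
by rewrite uN orbb inE uS u10 rpredN.
Qed.

(** The second components live in types depending on the first, so they are compared only after d is
    identified with the gcd. *)
Lemma inv_frac_eq N d (b : Zmod (codiv N d)) (a c : int) :
  (inv_frac N a c == mk_inv b) =
  (gcdn `|c| N == d) && (Zres (codiv N d) (a * (c %/ d%:Z)%Z) == b).
Proof.
rewrite /inv_frac; move: (gcdn _ _) => e; have [e_d | e_d] /= := eqVneq e d.
  by case: _ / e_d b => b; rewrite /mk_inv eq_Tagged.
by apply/eqP => /(congr1 tag) /= e_d'; rewrite e_d' eqxx in e_d.
Qed.

Lemma coprimez_div_gcd (N : nat) (c : int) : (0 < N)%N ->
  exists2 k : int, c = (gcdn `|c| N)%:Z * k & coprimez k (N %/ gcdn `|c| N)%N.
Proof.
move=> N0; set d := gcdn _ _.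
have d0 : (0 < d)%N by rewrite gcdn_gt0 N0 orbT.
have /dvdzP[k ek] : (d%:Z %| c)%Z by rewrite dvdzE dvdn_gcdl.
exists k; first by rewrite mulrC.
rewrite coprimezE /= /coprime -(eqn_pmul2r d0) muln_gcdl mul1n divnK ?dvdn_gcdr //.
by rewrite -[X in gcdn (_ * X)]/`|d%:Z|%N -abszM -ek.
Qed.

(** If g sends infinity to the reduced fraction a/c, the invariant forces gcd(c, N) = d. Then N | m
    c^2 holds exactly for the multiples m of d'/d'', the least positive one being d'/d''. *)
Lemma is_width_chi N d (b : Zmod (codiv N d)) (C : C0 N) : (0 < N)%N ->
  chi C = mk_inv b -> is_width C ((N %/ d) %/ codiv N d)%N.
Proof.
move=> N0 /eqP + g gS gC; rewrite -gC /=.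
have ac : coprimez (g ord0 ord0) (g ord_max ord0).
  apply/coprimezP; exists (g ord_max ord_max, - g ord0 ord_max) => /=.
  by move: gS; rewrite inE det2 => /eqP <-; ring.
rewrite chi_cusp // inv_frac_eq => /andP[/eqP ed _].
have [k] := coprimez_div_gcd (g ord_max ord0) N0.
rewrite ed => ek ck.
have dN : (d %| N)%N by rewrite -ed dvdn_gcdr.
have d0 := dvdn_gt0 N0 dN.
have d'0 : (0 < N %/ d)%N by rewrite divn_gt0 // dvdn_leq.
have iE m : conj_transl_in N g m = ((N %/ d) %/ codiv N d %| m)%N.
  rewrite conj_transl_inE // ek -{1}(divnK dN) [(_ * d)%N]mulnC.
  by rewrite dvdz_mul_sqr.
split=> [|| m m0]; rewrite ?iE //; last exact: dvdn_leq.
by rewrite divn_gt0; [apply: dvdn_leq | apply: dvdn_gt0 d'0 _]; rewrite ?codiv_dvdr.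
Qed.

(** * The cusps 1/j of invariant (d; b), parametrized by [K b] *)

Theorem theorem1p16 (N d : nat) (hN : (1 < N)%N) (hd : (1 < d)%N)
    (hdN : (d %| N)%N) (b : Zmod (codiv N d))
    (hb : b \in Zmod_units (codiv N d)) :
  (forall C : C0 N, chi C = mk_inv b ->
     is_width C
       (\sum_(j < N | (1 < gcdn j N)%N &&
                      (chi (cusp N (P1pt 1 j%:Q))%R == mk_inv b))
          W (Zres N j%:Z))%N) /\
  ((N %/ d) %/ codiv N d = \sum_(k in K b) W (Zres N (d * Zlift k)%N%:Z))%N.
Proof.
have N0 := ltnW hN; have d0 := ltnW hd.
have d'0 : (0 < N %/ d)%N by rewrite divn_gt0 // dvdn_leq.
have sumK := sum_W_K N0 hdN hb.
split=> [C chiC|].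
  suff -> : (\sum_(j < N | (1 < gcdn j N)%N &&
       (chi (cusp N (P1pt 1 j%:Q))%R == mk_inv b)) W (Zres N j%:Z))%N
     = ((N %/ d) %/ codiv N d)%N by exact: is_width_chi chiC.
  rewrite -sumK.
  have lt_dk (k : Zmod (N %/ d)) : (d * k < N)%N.
    by rewrite -[X in (_ < X)%N](divnK hdN) mulnC ltn_pmul2r //;
      apply: leq_trans (ltn_ord k) _; rewrite prednK.
  (* The bijection is k -> d k, with inverse j -> j/d on the j such that gcd(j, N) = d. *)
  pose F (k : Zmod (N %/ d)) : 'I_N := Ordinal (lt_dk k).
  pose G (j : 'I_N) : Zmod (N %/ d) := inZp (j %/ d).
  (* The invariant of 1/j is given by gcd(j, N) and j divided by it; when this gcd is d, d > 1
     yields the first condition. *)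
  have QE (j : 'I_N) : (1 < gcdn j N)%N && (chi (cusp N (P1pt 1 j%:Q)) == mk_inv b)
      = (gcdn j N == d) && (Zres (codiv N d) (j %/ d)%N%:Z == b).
    have -> : chi (cusp N (P1pt 1 j%:Q)) = inv_frac N 1 j%:Z.
      by rewrite -chi_cusp // coprimezE /= /coprime gcd1n.
    rewrite inv_frac_eq mul1r divz_nat /=.
    by case: eqP => [-> | _]; rewrite ?hd ?andbF.
  rewrite (eq_bigl _ _ QE) (reindex_onto F G).
    apply: congr_big => // k.
    have -> : G (F k) == k.
      by apply/eqP/val_inj; rewrite /= mulKn // modn_small.
    rewrite /= -[k in RHS]Zres_val in_K // mulKn // andbT; congr (_ && _).
    (* gcd(d k, d d') = d amounts to gcd(k, d') = 1. *)
    rewrite coprimezE /= /coprime -[RHS](eqn_pmul2l d0) muln_gcdr muln1.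
    by rewrite [(d * (N %/ d))%N]mulnC divnK.
  move=> j /andP[/eqP gj _]; apply: val_inj => /=.
  have dj : (d %| j)%N by rewrite -gj dvdn_gcdl.
  by rewrite prednK // modn_small ?ltn_divLR ?divnK // mulnC divnK.
(* [Zlift k] differs from k only at k = 0, where it is d'; this shifts d k by N. *)
rewrite -sumK; apply: eq_bigr => k _; congr W; apply: Zres_eq.
have -> : N%:Z = d%:Z * (N %/ d)%N%:Z by rewrite -PoszM mulnC divnK.
rewrite PoszM -mulrBr dvdz_mul // /Zlift.
by case: eqP => [->|_]; rewrite ?subrr ?dvdz0 // sub0r rpredN.
Qed.
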